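(* Let $k\in\mathbb{N}$, let $s\geq 0$ be an integer, let $\mathbf{a}^{1},\dots,\mathbf{a}^{k}\in\mathbb{R}^{2}$ be pairwise linearly independent vectors, and let $f\in C^{s}(\mathbb{R}^{2})$ be a function of the form $$f(\mathbf{x})=\sum_{i=1}^{k}f_{i}(\mathbf{a}^{i}\cdot\mathbf{x}),\qquad \mathbf{x}\in\mathbb{R}^{2},$$ where $f_{1},\dots,f_{k}:\mathbb{R}\to\mathbb{R}$ are arbitrary functions (no regularity assumed). Then there exist functions $g_{i}\in C^{s}(\mathbb{R})$, $i=1,\dots,k$, such that $$f(\mathbf{x})=\sum_{i=1}^{k}g_{i}(\mathbf{a}^{i}\cdot\mathbf{x})\qquad\text{for all }\mathbf{x}\in\mathbb{R}^{2}.$$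
   Context: All functions are real-valued. $\mathbf{a}\cdot\mathbf{x}$ denotes the standard inner product on $\mathbb{R}^{2}$. $C^{s}(\mathbb{R}^{m})$ is the class of $s$-times continuously differentiable functions on $\mathbb{R}^{m}$, with the convention $C^{0}(\mathbb{R}^{m})=C(\mathbb{R}^{m})$ (continuous functions). *)

(* Defs.v *)
From mathcomp Require Import all_boot all_order all_algebra.
From mathcomp Require Import all_classical all_reals all_analysis.

Set Implicit Arguments.
Unset Strict Implicit.
Unset Printing Implicit Defensive.

Import Order.TTheory GRing.Theory Num.Theory.
Import numFieldNormedType.Exports.

Local Open Scope classical_set_scope.
Local Open Scope ring_scope.

Definition dot (R : realType) (m : nat) (a x : 'rV[R]_m) : R :=
  \sum_(j < m) a ord0 j * x ord0 j.

(* The class C^s(R^m): all iterated partial derivatives of order at most s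
   exist everywhere and are continuous.  The topology on 'rV[R]_m is the one
   of the sup norm, i.e. the usual one. *)
Fixpoint Cs (R : realType) (m s : nat) (f : 'rV[R]_m -> R) : Prop :=
  continuous f /\
  match s with
  | 0%N => True
  | s'.+1 => forall j : 'I_m,
      (forall x, derivable f x (delta_mx ord0 j)) /\
      Cs s' ('D_(delta_mx ord0 j) f)
  end.

(* The class C^s(R), for functions on R itself rather than on 'rV[R]_1. *)
Fixpoint Cs1 (R : realType) (s : nat) (g : R -> R) : Prop :=
  continuous g /\
  match s with
  | 0%N => True
  | s'.+1 => (forall t, derivable g t 1) /\ Cs1 s' (derive1 g)
  end.

(* Main.v *)
(* Induction on the number k of directions.  Let l be orthogonal to one direction
   b.  Differences of f along l only involve the k - 1 other directions, and so do
   limits and averages of such differences: a linear functional on all functions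
   R -> R that extends the limit (or the mean over [0, 1]) may be applied to the
   arbitrary f_i.
   If s > 0, the derivative of f along l is thus a sum of k - 1 ridge functions of
   class C^(s-1), which may be taken regular by induction; integrating them and
   subtracting leaves a function constant along l, hence a ridge function in the
   direction b.
   If s = 0, let A f x be the mean of f over the segment [x, x + l].  Then f - A f
   is covered by the induction hypothesis, and so is the derivative
   f (x + l) - f x of A f along l, to which the previous argument applies. *)

Require Import Defs.
From HB Require Import structures.
From mathcomp Require Import ring lra.
From mathcomp Require Import all_boot all_order all_algebra.
From mathcomp Require Import all_classical all_reals all_analysis.

Import Order.TTheory GRing.Theory Num.Theory.
Import numFieldNormedType.Exports.

Local Open Scope classical_set_scope.
Local Open Scope ring_scope.

Set Implicit Arguments.
Unset Strict Implicit.
Unset Printing Implicit Defensive.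

(** * Construction of linear functionals *)

(* Zorn's lemma gives a maximal subspace [M] containing [W] but not [e]; then
   [V = M + K e] and [L] is the [e]-coordinate. *)
Lemma separating_functional (K : fieldType) (V : lmodType K) (W : set V) (e : V)
    (W0 : W 0) (Wlin : forall (c : K) u v, W u -> W v -> W (c *: u + v))
    (We : ~ W e) :
  exists L : {scalar V}, (forall w, W w -> L w = 0) /\ L e = 1.
Proof.
(* Closure is asked of the union of [X] and [W], so that the empty set, which is the union of the
   empty chain, satisfies [P]. *)
pose P (X : set V) := (forall (c : K) u v, (X `|` W) u -> (X `|` W) v ->
  (X `|` W) (c *: u + v)) /\ ~ X e.
have [F FP Ftot|A [[Alin Ae] Amax]] := @Zorn_bigcup V P.
  split=> [c u v|[X FX Xe]]; last by have [_] := FP X FX.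
  have sub X x : F X -> (X `|` W) x -> (\bigcup_(Y in F) Y `|` W) x.
    by move=> FX [Xx|Wx]; [left; exists X|right].
  move=> [[X FX Xu]|Wu] [[Y FY Yv]|Wv].
  - have [XY|YX] := Ftot X Y FX FY.
    + by apply: (sub Y _ FY); apply: (FP Y FY).1; left=> //; exact: XY.
    + by apply: (sub X _ FX); apply: (FP X FX).1; left=> //; exact: YX.
  - by apply: (sub X _ FX); apply: (FP X FX).1; [left|right].
  - by apply: (sub Y _ FY); apply: (FP Y FY).1; [right|left].
  - by right; exact: Wlin.
pose M := A `|` W.
have M0 : M 0 by right.
have Me : ~ M e by case.
have MZ c u : M u -> M (c *: u) by move=> Mu; rewrite -[_ *: _]addr0; exact: Alin.
have ex u : exists c, M (u - c *: e).
  have [Mu|Mu] := pselect (M u); first by exists 0; rewrite scale0r subr0.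
  (* [B] is the span of [u] and [M]. By maximality it contains [e], and solving for [u] gives the
     coordinate. *)
  pose B := [set x | exists c : K, exists2 m, M m & x = c *: u + m].
  have WB : W `<=` B.
    by move=> w Ww; exists 0, w; [right|rewrite scale0r add0r].
  have BE : B `|` W = B by rewrite setUC; exact/setUidPr.
  have [Be|Be] := pselect (B e); last first.
    exfalso; apply: (Amax B).
      split; first by move=> x Ax; exists 0, x; [left|rewrite scale0r add0r].
      move=> /(_ u) BA; apply: Mu; left; apply: BA.
      by exists 1, 0; rewrite // scale1r addr0.
    split=> // c x y; rewrite BE => -[cx [mx Mx ->]] [cy [my My ->]].
    exists (c * cx + cy), (c *: mx + my); first exact: Alin.
    by rewrite scalerDr scalerA scalerDl addrACA.
  move: Be => [c [m Mm eE]]; have c0 : c != 0.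
    by apply: contra_not_neq Me => c0; rewrite eE c0 scale0r add0r.
  exists c^-1; rewrite eE scalerDr scalerA mulVf// scale1r opprD addrA subrr add0r.
  by rewrite -scaleNr; exact: MZ.
have [L LP] := choice ex.
(* Two distinct coordinates would put a nonzero multiple of [e], hence [e] itself, in [M]. *)
have uniq u c : M (u - c *: e) -> L u = c.
  move=> Mc; apply/eqP/negPn/negP => ne; apply: Me.
  have -> : e = (c - L u)^-1 *: (-1 *: (u - c *: e) + (u - L u *: e)).
    rewrite scaleN1r opprB addrA subrK -scalerBl scalerA mulVf ?scale1r//.
    by rewrite subr_eq0 eq_sym.
  by apply: MZ; apply: Alin; [exact: Mc|exact: LP].
have Llin : linear_for *%R L.
  move=> c u v; apply: uniq.
  have -> : c *: u + v - (c * L u + L v) *: e =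
      c *: (u - L u *: e) + (v - L v *: e).
    by rewrite scalerDl scalerBr scalerA addrACA -opprD -scalerDl.
  by apply: Alin; exact: LP.
pose Lp : {scalar V} := HB.pack L (GRing.isLinear.Build _ _ _ _ L Llin).
exists Lp; split=> [w Ww|]; apply: uniq.
  by rewrite scale0r subr0; right.
by rewrite scale1r subrr.
Qed.

(** * Mean value theorem and primitives on the real line *)

(** The endpoints may come in either order because increments of both signs occur below. *)
Lemma MVT_unordered (R : realType) (f df : R -> R) (a b : R) :
  (forall x : R, Num.min a b <= x <= Num.max a b -> is_derive x 1 f (df x)) ->
  exists2 c, Num.min a b <= c <= Num.max a b & f b - f a = df c * (b - a).
Proof.
wlog ab : a b / a <= b => [th fd|].
  have /orP[ab|ba] := le_total a b; first exact: th.
  have [|c cI fE] := th b a ba; first by rewrite minC maxC.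
  exists c; first by rewrite minC maxC.
  by rewrite -opprB fE -mulrN opprB.
rewrite min_l// max_r// => fd.
have [x /[!in_itv]/= /andP[/ltW ax /ltW xb]||c /[!in_itv] cI fE] :=
    @MVT_segment R f df a b ab; last by exists c.
  by apply: fd; rewrite ax.
apply: derivable_within_continuous => x /[!in_itv]/= xI.
by have [] := fd _ xI.
Qed.

Lemma primitive_half_line (R : realType) (g : R -> R) (a : R) :
  continuous g ->
  exists G : R -> R, forall t : R, a < t -> is_derive t 1 G (g t).
Proof.
move=> gc; exists (fun x => \int[lebesgue_measure]_(t in `[a, x]) g t).
move=> t at_.
have [||d1 d2] := @continuous_FTC1_closed R g a t (t + 1) _ _ at_ (gc t).
- by rewrite ltrDl.
- apply: continuous_compact_integrable; first exact: segment_compact.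
  exact: continuous_subspaceT.
by apply: DeriveDef d1 _; rewrite -derive1E.
Qed.

Lemma is_derive_comp_opp (R : realType) (g : R -> R) (t d : R) :
  is_derive (- t) 1 g d -> is_derive t 1 (fun x => g (- x)) (- d).
Proof.
move=> gd; have := @is_derive1_comp R g -%R t _ _ gd (is_deriveNid _ _).
by rewrite mulrN1.
Qed.

(** Integrals from a base point give primitives on two overlapping half-lines, the left one by
    reflecting [g]; they are glued at [0]. *)
Lemma continuous_primitive (R : realType) (g : R -> R) :
  continuous g -> exists G : R -> R, forall t : R, is_derive t 1 G (g t).
Proof.
move=> gc.
have [P Pd] := @primitive_half_line R g (-1) gc.
have [|Q Qd] := @primitive_half_line R (fun x => g (- x)) (-1).
  by move=> x; apply: continuous_comp; [exact: opp_continuous|exact: gc].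
(* The constant is chosen so that [Q' 0 = P 0]. *)
pose Q' x := P 0 + Q 0 - Q (- x).
have Q'd (t : R) : t < 1 -> is_derive t 1 Q' (g t).
  move=> t1; have Nt1 : -1 < - t by rewrite ltrN2.
  have Qt := is_derive_comp_opp (Qd _ Nt1).
  by apply: is_derive_eq (is_deriveB (is_derive_cst (P 0 + Q 0) t 1) Qt) _;
    rewrite opprK opprK add0r.
(* On the overlap [P - Q'] has derivative zero and vanishes at [0]; hence the glued function is also
   differentiable at [0]. *)
have PQ (t : R) : -1 < t < 1 -> P t = Q' t.
  move=> /andP[t1 t2].
  have [x|c _] := @MVT_unordered R (P - Q') (fun x => g x - g x) 0 t.
    rewrite ge_min le_max => xI; apply: is_deriveB; [apply: Pd|apply: Q'd].
      by case/andP: xI => /orP[|] /(lt_le_trans _)-> //; rewrite ltrN10.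
    by case/andP: xI => _ /orP[|] /le_lt_trans->.
  by rewrite subrr mul0r /Q' /= !fctE oppr0 => h; lra.
pose G x := if x < 0 then Q' x else P x.
exists G => t; have [t0|t0] := ltP t 0.
  apply: near_eq_is_derive (Q'd t (lt_trans t0 ltr01)).
  by near=> x; rewrite /G ifT//; near: x; exact: lt_nbhsl.
apply: near_eq_is_derive (Pd t _); last by apply: lt_le_trans t0; rewrite ltrN10.
near=> x; rewrite /G; case: ltP => // x0; apply: PQ.
rewrite (lt_trans x0)// andbT.
by near: x; apply: lt_nbhsr; exact: (lt_le_trans (ltrN10 _)).
Unshelve. all: by end_near.
Qed.

(** * Extensions of the limit and of the mean over the unit interval *)

(* [L] is defined on every function, with or without a limit: it is a
   discontinuous linear extension of the limit functional. *)
Lemma limit_functional (R : realType) :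
  exists L : {scalar (R -> R)},
    forall (u : R -> R) (l : R), u h @[h --> 0^'] --> l -> L u = l.
Proof.
have [|||L [L0 L1]] :=
  @separating_functional R (R -> R) [set u | u h @[h --> 0^'] --> 0] (cst 1).
- exact: cvg_cst.
- move=> c u v /= u0 v0.
  have : c * u h + v h @[h --> 0^'] --> c * 0 + 0.
    by apply: cvgD v0; apply: cvgM u0; exact: cvg_cst.
  by rewrite mulr0 addr0.
- move=> /(cvg_unique (@Rhausdorff R) (cvg_cst (1 : R)))/eqP.
  by rewrite oner_eq0.
exists L => u l ul.
suff : L (u - l *: cst 1) = 0.
  by rewrite linearB linearZ/= L1 mulr1 => /eqP; rewrite subr_eq0 => /eqP.
have -> : l *: cst 1 = cst l :> (R -> R) by apply/funext => h; exact: mulr1.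
have : u h - l @[h --> 0^'] --> l - l by apply: cvgB ul _; exact: cvg_cst.
by rewrite subrr; exact: L0.
Qed.

(** The subspace to be killed consists of the derivatives of functions with equal values at [0] and
    [1]; by the mean value theorem it does not contain the constant [1]. Thus [L] extends the mean
    over the unit interval from functions with a primitive to all functions, measurable or not. *)
Lemma mean_functional (R : realType) :
  exists L : {scalar (R -> R)},
    forall G g : R -> R, (forall t : R, is_derive t 1 G (g t)) -> L g = G 1 - G 0.
Proof.
have [|||L [L0 L1]] := @separating_functional R (R -> R)
  [set g | exists2 G : R -> R, forall t : R, is_derive t 1 G (g t) & G 1 = G 0]
  (cst 1).
- by exists (cst 0) => // t; exact: is_derive_cst.
- move=> c g h [G Gd G1] [H Hd H1]; exists (c *: G + H); last first.
    by rewrite !fctE G1 H1.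
  by move=> t; exact: is_deriveD.
- move=> [G Gd G1].
  have [c _] := @MVT_unordered R G (cst 1) 0 1.
  by rewrite G1 subrr subr0 mulr1 => /esym/eqP; rewrite oner_eq0.
exists L => G g Gd.
suff : L (g - (G 1 - G 0) *: cst 1) = 0.
  by rewrite linearB linearZ/= L1 mulr1 => /eqP; rewrite subr_eq0 => /eqP.
apply: L0; exists (G - (G 1 - G 0) *: id); last first.
  by rewrite !fctE /GRing.scale/=; lra.
by move=> t; exact: is_deriveB.
Qed.

(** * Directional derivatives *)

Lemma is_deriveP (R : realType) (V : normedModType R) (f : V -> R) (x v : V)
    (d : R) :
  is_derive x v f d <-> h^-1 * (f (h *: v + x) - f x) @[h --> 0^'] --> d.
Proof.
split=> [[fx <-]|fd]; first exact: fx.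
by split; [exact: cvgP fd|exact: cvg_lim fd].
Qed.

Section directional_derivatives.
Variables (R : realType) (V : normedModType R).
Implicit Types (f : V -> R) (x v w : V).

(** Both difference quotients are the same function of [h]. This makes the one-variable mean value
    theorem and chain rule available along lines. *)
Lemma is_derive_lineP f x v (t d : R) :
  is_derive (x + t *: v) v f d <-> is_derive t 1 (fun u : R => f (x + u *: v)) d.
Proof.
rewrite is_deriveP (is_deriveP _ t).
suff -> : (fun h : R => h^-1 * (f (h *: v + (x + t *: v)) - f (x + t *: v))) =
  (fun h => h^-1 * (f (x + (h *: (1 : R) + t) *: v) - f (x + t *: v))) by [].
by apply/funext => h; rewrite scalerDl [h%:A]mulr1 addrCA.
Qed.

(** This is the one-variable chain rule along the line, so [c = 0] needs no separate case. *)
Lemma is_derive_scalev f x v (c d : R) :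
  is_derive x v f d -> is_derive x (c *: v) f (c * d).
Proof.
rewrite -[x in X in X -> _]addr0 -(scale0r v) => /is_derive_lineP fd.
rewrite -[x]addr0 -(scale0r (c *: v)); apply/is_derive_lineP.
have cd : is_derive (0 : R) (1 : R) ( *%R c) c.
  by have := is_deriveZ c (is_derive_id (0 : R) (1 : R)); rewrite [c%:A]mulr1.
rewrite mulrC.
rewrite [X in is_derive _ _ X](_ : _ = (fun u => f (x + u *: v)) \o *%R c).
  by apply: is_derive1_comp; rewrite mulr0.
by apply/funext => u /=; rewrite scalerA mulrC.
Qed.

(* The increment along [v + w] splits into one along [w] from [x] and one along
   [v] from a moving base point; the latter is handled by the mean value theorem,
   whence the continuity of [Dv]. *)
Lemma is_derive_addv f x v w (Dv : V -> R) (d : R) :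
  (forall y, is_derive y v f (Dv y)) -> {for x, continuous Dv} ->
  is_derive x w f d -> is_derive x (v + w) f (Dv x + d).
Proof.
move=> fv Dvc /is_deriveP fw; apply/is_deriveP.
(* [xi h] is the intermediate point of the mean value theorem on the segment in direction [v]; its
   bound makes it tend to [0] with [h]. *)
have /choice[xi xiP] (h : R) : exists xi : R, `|xi| <= `|h| /\
    f (h *: v + (h *: w + x)) - f (h *: w + x) = Dv (xi *: v + (h *: w + x)) * h.
  have [|c ch] := @MVT_unordered R (fun u => f ((h *: w + x) + u *: v))
      (fun u => Dv ((h *: w + x) + u *: v)) 0 h.
    by move=> u _; apply/is_derive_lineP.
  rewrite scale0r addr0 subr0 => E; exists c; split; last first.
    by rewrite [h *: v + _]addrC E [c *: v + _]addrC.
  move: ch; rewrite ge_min le_max; case: (leP 0 h) => [h0|h0].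
    by rewrite (ger0_norm h0) => ?; rewrite ger0_norm; lra.
  by rewrite (ltr0_norm h0) => ?; rewrite ler0_norm; lra.
have id0 : (h : R) @[h --> 0^'] --> (0 : R) by exact: nbhs_dnbhs.
have xi0 : xi h @[h --> 0^'] --> 0.
  apply: norm_cvg0; apply: (@squeeze_cvgr _ _ _ _ (cst 0) Num.norm).
  - near=> h; rewrite /cst normr_ge0/=; exact: (xiP h).1.
  - exact: cvg_cst.
  - by rewrite -[X in _ --> X](@normr0 _ R); exact: cvg_norm id0.
have base : (xi h *: v + (h *: w + x)) @[h --> 0^'] --> x.
  have : (xi h *: v + (h *: w + x)) @[h --> 0^'] --> 0 *: v + (0 *: w + x).
    apply: cvgD; first exact: cvgZr_tmp.
    by apply: cvgD; [exact: cvgZr_tmp|exact: cvg_cst].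
  by rewrite !scale0r !add0r.
have : Dv (xi h *: v + (h *: w + x)) + h^-1 * (f (h *: w + x) - f x)
    @[h --> 0^'] --> Dv x + d.
  by apply: cvgD fw; exact: cvg_comp base Dvc.
apply: cvg_trans; apply: near_eq_cvg; near=> h.
have h0 : h != 0 by near: h; exact: nbhs_dnbhs_neq.
rewrite /=.
have -> : f (h *: (v + w) + x) - f x =
    f (h *: v + (h *: w + x)) - f (h *: w + x) + (f (h *: w + x) - f x).
  by rewrite addrA subrK scalerDr addrA.
by rewrite (xiP h).2 [RHS]mulrDr mulrCA mulVf// mulr1.
Unshelve. all: by end_near.
Qed.

End directional_derivatives.

(** * The inner product and derivatives of ridge functions *)

Lemma continuous_mull (R : realType) (T : topologicalType) (f : T -> R) (c : R) :
  continuous f -> continuous (fun x => c * f x).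
Proof. by move=> fc x; apply: (cvgM (cvg_cst _)); exact: fc. Qed.

Lemma continuous_add (R : realType) (T : topologicalType) (f g : T -> R) :
  continuous f -> continuous g -> continuous (fun x => f x + g x).
Proof. by move=> fc gc x; apply: cvgD; [exact: fc|exact: gc]. Qed.

Section dot_product.
Variables (R : realType) (m : nat).
Implicit Types a x y : 'rV[R]_m.

Lemma dotD a x y : dot a (x + y) = dot a x + dot a y.
Proof. by rewrite /dot -big_split; apply: eq_bigr => j _; rewrite mxE mulrDr. Qed.

Lemma dotZ a (c : R) x : dot a (c *: x) = c * dot a x.
Proof. by rewrite /dot mulr_sumr; apply: eq_bigr => j _; rewrite mxE mulrCA. Qed.

Lemma dot_delta a j : dot a (delta_mx ord0 j) = a ord0 j.
Proof.
rewrite /dot (bigD1 j)//= big1 ?addr0 ?mxE ?eqxx ?mulr1// => i ij.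
by rewrite mxE (negbTE ij) andbF mulr0.
Qed.

Lemma dot_continuous a : continuous (dot a).
Proof.
apply: continuous_big => [|j _]; first exact: add_continuous.
exact/continuous_mull/coord_continuous.
Qed.

End dot_product.

(** Moving along [l] changes [dot a] at the constant rate [dot a l], possibly zero. *)
Lemma is_derive_ridge (R : realType) m (a x l : 'rV[R]_m) (G : R -> R) (d : R) :
  is_derive (dot a x) 1 G d ->
  is_derive x l (fun y => G (dot a y)) (dot a l * d).
Proof.
move=> /(is_derive_scalev (dot a l))/is_deriveP Gd; apply/is_deriveP.
rewrite [X in X @ _ --> _](_ : _ = fun h : R =>
  h^-1 * (G (h *: (dot a l *: (1 : R)) + dot a x) - G (dot a x)))//.
by apply/funext => h; rewrite dotD dotZ [_%:A]mulr1.
Qed.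

(** The direction [l] is expanded over the canonical basis and its terms are added one at a time by
    [is_derive_addv], which asks for a continuous derivative only in the direction being added. *)
Lemma is_derive_partials (R : realType) m (f : 'rV[R]_m -> R)
    (D : 'I_m -> 'rV[R]_m -> R) (l x : 'rV[R]_m) :
  (forall j y, is_derive y (delta_mx ord0 j) f (D j y)) ->
  (forall j, continuous (D j)) ->
  is_derive x l f (\sum_(j < m) l ord0 j * D j x).
Proof.
move=> fD Dc; rewrite [l in is_derive _ l](row_sum_delta l).
elim: (index_enum _) => [|j r ih]; first by rewrite !big_nil; exact: is_derive0.
rewrite !big_cons.
apply: (@is_derive_addv _ _ _ _ _ _ (fun y => l ord0 j * D j y)) => //.
  by move=> y; exact: is_derive_scalev.
exact/continuous_mull/Dc.
Qed.

(** * Stability properties of the classes [Cs] and [Cs1] *)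

Section Cs_closure.
Variables (R : realType) (m : nat).
Implicit Types f g : 'rV[R]_m -> R.

Lemma Cs_continuous s f : Cs s f -> continuous f.
Proof. by case: s => [|s] []. Qed.

Lemma Cs_cst s (c : R) : Cs s (fun _ : 'rV[R]_m => c).
Proof.
elim: s c => [|s ih] c; split=> //; try exact: cst_continuous.
move=> j; split=> [x|]; first exact: derivable_cst.
by rewrite [X in Cs s X](_ : _ = fun=> 0)//; apply/funext => x; exact: derive_cst.
Qed.

Lemma CsD s f g : Cs s f -> Cs s g -> Cs s (fun x => f x + g x).
Proof.
elim: s f g => [|s ih] f g [fc fd] [gc gd]; split=> //;
  try by apply: continuous_add.
move=> j; have [fj fj'] := fd j; have [gj gj'] := gd j.
split=> [x|]; first exact: derivableD.
have -> : 'D_(delta_mx ord0 j) (fun x => f x + g x) =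
  (fun x => 'D_(delta_mx ord0 j) f x + 'D_(delta_mx ord0 j) g x).
  by apply/funext => x; exact: deriveD.
exact: ih.
Qed.

Lemma CsZ s f (c : R) : Cs s f -> Cs s (fun x => c * f x).
Proof.
elim: s f => [|s ih] f [fc fd]; split=> //;
  try exact: (@continuous_mull _ _ _ c).
move=> j; have [fj fj'] := fd j.
split=> [x|]; first exact: derivableZ.
have -> : 'D_(delta_mx ord0 j) (fun x => c * f x) =
  (fun x => c * 'D_(delta_mx ord0 j) f x).
  by apply/funext => x; exact: deriveZ.
exact: ih.
Qed.

Lemma Cs_sum s n (F : 'I_n -> 'rV[R]_m -> R) :
  (forall i, Cs s (F i)) -> Cs s (fun x => \sum_(i < n) F i x).
Proof.
move=> FC; elim: (index_enum _) => [|i r ih].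
  rewrite [X in Cs s X](_ : _ = fun=> 0); first exact: Cs_cst.
  by apply/funext => x; rewrite big_nil.
rewrite [X in Cs s X](_ : _ = fun x => F i x + \sum_(i <- r) F i x).
  exact: CsD.
by apply/funext => x; rewrite big_cons.
Qed.

End Cs_closure.

Section Cs1_closure.
Variable R : realType.
Implicit Types g : R -> R.

Lemma Cs1_continuous s g : Cs1 s g -> continuous g.
Proof. by case: s => [|s] []. Qed.

Lemma Cs1D s g h : Cs1 s g -> Cs1 s h -> Cs1 s (fun t => g t + h t).
Proof.
elim: s g h => [|s ih] g h [gc gd] [hc hd]; split=> //;
  try by apply: continuous_add.
move: gd hd => [gd gd'] [hd hd'].
split=> [x|]; first exact: derivableD.
have -> : derive1 (fun x => g x + h x) = (fun x => derive1 g x + derive1 h x).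
  by apply/funext => x; rewrite !derive1E; exact: deriveD.
exact: ih.
Qed.

Lemma Cs1Z s g (c : R) : Cs1 s g -> Cs1 s (fun t => c * g t).
Proof.
elim: s g => [|s ih] g [gc gd]; split=> //;
  try exact: (@continuous_mull _ _ _ c).
move: gd => [gd gd'].
split=> [x|]; first exact: derivableZ.
have -> : derive1 (fun x => c * g x) = (fun x => c * derive1 g x).
  by apply/funext => x; rewrite !derive1E; exact: deriveZ.
exact: ih.
Qed.

Lemma Cs1_cst s (c : R) : Cs1 s (fun _ => c).
Proof.
elim: s c => [|s ih] c; split=> //; try exact: cst_continuous.
split=> [x|]; first exact: derivable_cst.
rewrite [X in Cs1 s X](_ : _ = fun=> 0)//.
by apply/funext => x; rewrite derive1E; exact: derive_cst.
Qed.

Lemma Cs1_primitive s (G g : R -> R) :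
  (forall t : R, is_derive t 1 G (g t)) -> Cs1 s g -> Cs1 s.+1 G.
Proof.
move=> Gd gs; split.
  by move=> t; apply/differentiable_continuous/derivable1_diffP; have [] := Gd t.
split=> [t|]; first by have [] := Gd t.
by rewrite (_ : derive1 G = g)//; apply/funext => t; rewrite derive1E derive_val.
Qed.

(** Along a multiple of a basis vector a single partial derivative enters, so no multivariate chain
    rule is needed. *)
Lemma Cs1_line s m (f : 'rV[R]_m -> R) (j : 'I_m) (c : R) :
  Cs s f -> Cs1 s (fun t => f (t *: (c *: delta_mx ord0 j))).
Proof.
elim: s f => [|s ih] f [fc fd]; split=> //;
  try by move=> x; apply: continuous_comp; [exact: scalel_continuous|exact: fc].
have [fj fj'] := fd j.
have D (t : R) : is_derive t 1 (fun t => f (t *: (c *: delta_mx ord0 j)))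
    (c * 'D_(delta_mx ord0 j) f (t *: (c *: delta_mx ord0 j))).
  have := @is_derive_lineP R _ f 0 (c *: delta_mx ord0 j) t
    (c * 'D_(delta_mx ord0 j) f (t *: (c *: delta_mx ord0 j))).
  rewrite add0r (_ : (fun u => _) = (fun t => f (t *: (c *: delta_mx ord0 j)))).
    by case=> + _; apply; apply/is_derive_scalev/derivableP.
  by apply/funext => u; rewrite add0r.
split=> [t|]; first by have [] := D t.
have -> : derive1 (fun t => f (t *: (c *: delta_mx ord0 j))) =
    (fun t => c * 'D_(delta_mx ord0 j) f (t *: (c *: delta_mx ord0 j))).
  by apply/funext => t; rewrite derive1E; have [] := D t.
exact: Cs1Z (ih _ fj').
Qed.

Lemma Cs_ridge s m (a : 'rV[R]_m) g : Cs1 s g -> Cs s (fun x => g (dot a x)).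
Proof.
elim: s g => [|s ih] g [gc gd]; split=> //;
  try by move=> x; apply: continuous_comp; [exact: dot_continuous|exact: gc].
move: gd => [gd gd'] j.
have D x : is_derive x (delta_mx ord0 j) (fun x => g (dot a x))
    (a ord0 j * derive1 g (dot a x)).
  rewrite -dot_delta derive1E; apply: is_derive_ridge; exact: derivableP.
split=> [x|]; first by have [] := D x.
have -> : 'D_(delta_mx ord0 j) (fun x => g (dot a x)) =
    (fun x => a ord0 j * derive1 g (dot a x)).
  by apply/funext => x; have [] := D x.
exact: CsZ (ih _ gd').
Qed.

End Cs1_closure.

(** * Orthogonality in the plane *)

Section plane.
Variable R : realType.
Implicit Types a b x : 'rV[R]_2.

(** This is the rotation by a quarter turn. *)
Definition perp b : 'rV[R]_2 :=
  \row_j (if j == ord0 then - b ord0 ord_max else b ord0 ord0).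

Lemma dot2E a x :
  dot a x = a ord0 ord0 * x ord0 ord0 + a ord0 ord_max * x ord0 ord_max.
Proof.
rewrite /dot !big_ord_recl big_ord0 addr0.
by congr (_ * _ + a _ _ * x _ _); exact/val_inj.
Qed.

Lemma dot_perp b : dot b (perp b) = 0.
Proof. by rewrite dot2E !mxE/=; ring. Qed.

Lemma row2P a b :
  a ord0 ord0 = b ord0 ord0 -> a ord0 ord_max = b ord0 ord_max -> a = b.
Proof.
move=> ab0 ab1; apply/rowP => -[[|[|//]] j].
  by rewrite (_ : Ordinal j = ord0)//; exact/val_inj.
by rewrite (_ : Ordinal j = ord_max)//; exact/val_inj.
Qed.

Lemma dot_eq0_perp b x : b != 0 -> dot b x = 0 -> exists t, x = t *: perp b.
Proof.
(* The scalar is read off by dividing by a nonzero coordinate of [b]. *)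
rewrite dot2E => b0 bx; have [b00|b00] := eqVneq (b ord0 ord0) 0.
  have b01 : b ord0 ord_max != 0.
    apply: contra_neq b0 => b01; apply: row2P; by rewrite ?b00 ?b01 mxE.
  exists (- x ord0 ord0 / b ord0 ord_max); apply: row2P; rewrite !mxE/=.
    by field.
  move: bx; rewrite b00 mul0r add0r mulr0 => /eqP.
  by rewrite mulf_eq0 (negbTE b01) => /eqP.
exists (x ord0 ord_max / b ord0 ord0); apply: row2P; rewrite !mxE/=; last by field.
apply: (mulfI b00).
rewrite -[LHS]addr0 -(subrr (b ord0 ord_max * x ord0 ord_max)) addrA bx.
by field.
Qed.

(** Otherwise [a] would be orthogonal to [perp b], hence a multiple of [perp (perp b) = - b]. *)
Lemma free_dot_perp a b : free [:: a; b] -> dot a (perp b) != 0.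
Proof.
rewrite free_cons seq1_free span_seq1 => /andP[ab b0].
apply: contra ab => /eqP abp.
have [||t aE] := @dot_eq0_perp (perp b) a.
- apply: contra_neq b0 => pb0; apply: row2P; rewrite mxE.
    by have := congr1 (fun v : 'rV_2 => v ord0 ord_max) pb0; rewrite !mxE.
  have := congr1 (fun v : 'rV_2 => v ord0 ord0) pb0; rewrite !mxE/= => /eqP.
  by rewrite oppr_eq0 => /eqP.
- by move: abp; rewrite !dot2E => <-; ring.
apply/vlineP; exists (- t); rewrite {1}aE; apply: row2P; rewrite !mxE/=; ring.
Qed.

End plane.

(** * Sums of ridge functions *)

(** The predicate [P] lets one notion cover both arbitrary components and components of class
    [Cs1]. *)
Definition ridge_rep (R : realType) m n (P : (R -> R) -> Prop)
    (a : 'I_n -> 'rV[R]_m) (f : 'rV[R]_m -> R) : Prop :=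
  exists g : 'I_n -> R -> R,
    (forall i, P (g i)) /\ forall x, f x = \sum_(i < n) g i (dot (a i) x).

Lemma ridge_repD (R : realType) m n s (a : 'I_n -> 'rV[R]_m) f h :
  ridge_rep (@Cs1 R s) a f -> ridge_rep (@Cs1 R s) a h ->
  ridge_rep (@Cs1 R s) a (fun x => f x + h x).
Proof.
move=> [g [gC fE]] [k [kC hE]]; exists (fun i t => g i t + k i t); split.
  by move=> i; exact: Cs1D.
by move=> x; rewrite fE hE -big_split.
Qed.

Lemma ridge_rep_recl (R : realType) m n (P : (R -> R) -> Prop)
    (a : 'I_n.+1 -> 'rV[R]_m) (g0 : R -> R) (g : 'I_n -> R -> R) f :
  P g0 -> (forall i, P (g i)) ->
  (forall x, f x =
    g0 (dot (a ord0) x) + \sum_(i < n) g i (dot (a (lift ord0 i)) x)) ->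
  ridge_rep P a f.
Proof.
move=> Pg0 Pg fE; exists (fun i => if unlift ord0 i is Some j then g j else g0).
split=> [i|x]; first by case: unlift.
rewrite fE big_ord_recl unlift_none; congr (_ + _).
by apply: eq_bigr => i _; rewrite liftK.
Qed.

(** By linearity [L] passes through the sum, and each resulting term depends on [x] only through
    [dot (a i) x]. The [phi i] can be arbitrary because [L] is defined on all functions. *)
Lemma ridge_rep_functional (R : realType) m n (a : 'I_n -> 'rV[R]_m)
    (L : {scalar (R -> R)}) (phi : 'I_n -> R -> R -> R) (F : 'rV[R]_m -> R -> R) :
  (forall x u, F x u = \sum_(i < n) phi i (dot (a i) x) u) ->
  ridge_rep (fun=> True) a (fun x => L (F x)).
Proof.
move=> FE; exists (fun i t => L (phi i t)); split=> // x.
rewrite -linear_sum; congr (L _); apply/funext => u.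
by rewrite FE fct_sumE.
Qed.

(* Subtracting primitives of the [g i], suitably scaled, leaves a function that is
   constant along [perp (a ord0)], i.e. a ridge function in the direction
   [a ord0]. *)
Lemma ridge_rep_of_derive (R : realType) n s (a : 'I_n.+1 -> 'rV[R]_2)
    (g : 'I_n -> R -> R) (h : 'rV[R]_2 -> R) :
  a ord0 != 0 ->
  (forall i, dot (a (lift ord0 i)) (perp (a ord0)) != 0) ->
  Cs s h ->
  (forall x, is_derive x (perp (a ord0)) h
    (\sum_(i < n) g i (dot (a (lift ord0 i)) x))) ->
  (forall i (G : R -> R), (forall t : R, is_derive t 1 G (g i t)) -> Cs1 s G) ->
  (forall i, continuous (g i)) ->
  ridge_rep (@Cs1 R s) a h.
Proof.
set b := a ord0; set l := perp b => b0 al hC hd GC gc.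
have /choice[G Gd] (i : 'I_n) :
    exists G : R -> R, forall t : R, is_derive t 1 G (g i t).
  exact: continuous_primitive.
(* Differentiating the ridge function of [G i] along [l] produces the factor
   [dot (a (lift ord0 i)) l], which [c i] cancels. *)
pose c i := (dot (a (lift ord0 i)) l)^-1.
pose H x := h x + \sum_(i < n) - c i * G i (dot (a (lift ord0 i)) x).
have HC : Cs s H.
  apply: CsD => //; apply: Cs_sum => i; apply: CsZ; apply: Cs_ridge.
  exact: GC (Gd i).
have Hd x : is_derive x l H 0.
  have -> : H = h + \sum_(i < n) (- c i *: (fun x => G i (dot (a (lift ord0 i)) x))).
    by apply/funext => y; rewrite /H !fctE fct_sumE.
  apply: is_derive_eq.
    apply: is_deriveD; apply: is_derive_sum => i; apply: is_deriveZ.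
    by apply: is_derive_ridge; exact: Gd.
  rewrite -big_split big1// => i _ /=.
  by rewrite /GRing.scale/= mulNr mulrA mulVf ?al// mul1r subrr.
have Hl x t : H (x + t *: l) = H x.
  rewrite -[RHS](_ : H (x + 0 *: l) = _); last by rewrite scale0r addr0.
  apply: (@is_derive_0_is_cst R (fun u => H (x + u *: l))) => u.
  by have [+ _] := is_derive_lineP H x l u 0; apply; exact: Hd.
have [j bj] : exists j, b ord0 j != 0.
  apply/existsP; apply: contraNT b0 => /existsPn b0.
  by apply/eqP/rowP => j; rewrite mxE; apply/eqP/negPn/b0.
(* [e] is normalized so that [dot b e = 1], and is a multiple of a basis vector so that [Cs1_line]
   applies. *)
pose e : 'rV[R]_2 := (b ord0 j)^-1 *: delta_mx ord0 j.
apply: (@ridge_rep_recl _ _ _ _ _ (fun t => H (t *: e))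
  (fun i t => c i * G i t)).
- exact: Cs1_line.
- by move=> i; apply: Cs1Z; exact: GC (Gd i).
(* [x] and [dot b x *: e] have the same inner product with [b], so they differ by a multiple of [l],
   along which [H] is constant. *)
move=> x; have [|t xE] := @dot_eq0_perp R b (x + - dot b x *: e) b0.
  by rewrite dotD dotZ /e dotZ dot_delta mulVf// mulr1 subrr.
have -> : H (dot b x *: e) = H x.
  rewrite -(Hl _ t) -[t *: l]xE.
  by rewrite scaleNr addrC subrK.
rewrite /H -addrA -big_split big1 ?addr0// => i _ /=.
by rewrite mulNr addNr.
Qed.

(** * The mean of a continuous function over a moving segment *)

Lemma continuous_translate (R : realType) (V : normedModType R) (f : V -> R)
    (l : V) : continuous f -> continuous (fun x => f (x + l)).
Proof.
move=> fc x; have : y + l @[y --> x] --> x + l.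
  by apply: cvgD; [exact: cvg_id|exact: cvg_cst].
by move=> zc; exact: cvg_comp zc (@fc _).
Qed.

Section mean_along.
Variables (R : realType) (V : normedModType R) (f : V -> R) (l : V).
Variable G : V -> R -> R.
Hypothesis fc : continuous f.
Hypothesis Gd : forall x (t : R), is_derive t 1 (G x) (f (x + t *: l)).

(** This is the mean of [f] over the segment from [x] to [x + l]. The primitive [G x] is chosen
    separately for each [x], with no regularity in [x], but its increment does not depend on the
    choice. *)
Let mean x := G x 1 - G x 0.

(** The mean value theorem for [G x - G y] turns the difference of two means into a difference of
    values of [f] at one parameter [c], which is small uniformly in [c] by compactness of the unit
    interval. *)
Lemma mean_continuous : continuous mean.
Proof.
move=> x; apply/cvgrPdist_lt => /= e e0.
have line_cvg (c : R) :
    f (z.2 + z.1 *: l) @[z --> (c, x)] --> f (x + c *: l).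
  have : z.2 + z.1 *: l @[z --> (c, x)] --> x + c *: l.
    by apply: cvgD; [exact: cvg_snd|apply: cvgZr_tmp; exact: cvg_fst].
  by move=> zc; exact: cvg_comp zc (@fc _).
have : \forall y \near x,
    `[0, 1] `<=` [set c : R | `|f (x + c *: l) - f (y + c *: l)| < e].
  have /compact_near_coveringP cov := @segment_compact R 0 1.
  apply: (cov V (nbhs x) (fun y c => `|f (x + c *: l) - f (y + c *: l)| < e)).
  move=> c _.
  have e20 : 0 < e / 2 by rewrite divr_gt0.
  have /cvgrPdist_lt/(_ _ e20) near1 := line_cvg c.
  have near2 : \forall c' \near c, `|f (x + c *: l) - f (x + c' *: l)| < e / 2.
    have : f (x + c' *: l) @[c' --> c] --> f (x + c *: l).
      have : x + c' *: l @[c' --> c] --> x + c *: l.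
        by apply: cvgD; [exact: cvg_cst|exact: scalel_continuous].
      by move=> zc; exact: cvg_comp zc (@fc _).
    by move=> /cvgrPdist_lt/(_ _ e20).
  near=> z => /=.
  rewrite [X in `|X|](_ : _ = (f (x + c *: l) - f (z.2 + z.1 *: l)) -
    (f (x + c *: l) - f (x + z.1 *: l))); last by ring.
  rewrite [e]splitr (le_lt_trans (ler_normB _ _))// ltrD//; near: z => //.
  exact: (cvg_fst near2).
apply: filterS => y xy.
have [c cI] := @MVT_unordered R (G x - G y)
  (fun c => f (x + c *: l) - f (y + c *: l)) 0 1 (fun c _ => is_deriveB _ _).
rewrite subr0 mulr1 !fctE => E.
have -> : mean x - mean y = f (x + c *: l) - f (y + c *: l).
  by rewrite -E /mean; ring.
by apply: xy; rewrite /= in_itv/=; move: cI; rewrite min_l// max_r.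
Unshelve. all: by end_near.
Qed.

(** On the line through [x], [G (x + u *: l)] and the shift of [G x] by [u] are primitives of the
    same function. Hence the mean at [x + u *: l] is [G x (1 + u) - G x u], which is differentiated
    at [u = 0]. *)
Lemma is_derive_mean x : is_derive x l mean (f (x + l) - f x).
Proof.
have shiftG (u t : R) : is_derive t 1 (fun s => G x (s + u)) (f (x + (t + u) *: l)).
  rewrite -[f _]mulr1.
  apply: (@is_derive1_comp R (G x) (fun s => s + u)).
  exact: is_derive_shift.
have meanE (u : R) : mean (x + u *: l) = G x (1 + u) - G x u.
  have := @is_derive_0_is_cst R
    (fun t => G (x + u *: l) t - G x (t + u)) 1 0.
  rewrite add0r /mean => H; apply/eqP; rewrite -subr_eq0.
  rewrite -[X in X == 0](_ : (G (x + u *: l) 1 - G x (1 + u)) -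
    (G (x + u *: l) 0 - G x u) = _); last by ring.
  rewrite subr_eq0; apply/eqP/H => t.
  apply: is_derive_eq (is_deriveB (Gd (x + u *: l) t) (shiftG u t)) _.
  by rewrite scalerDl [t *: l + _]addrC addrA subrr.
rewrite -[x in is_derive x](addr0 x) -(scale0r l); apply/is_derive_lineP.
rewrite (_ : (fun u => mean _) = (fun u => G x (u + 1) - G x u)); last first.
  by apply/funext => u; rewrite meanE [1 + u]addrC.
have G1 : is_derive (0 : R) 1 (fun u => G x (u + 1)) (f (x + l)).
  by have := shiftG 1 0; rewrite add0r scale1r.
have G0 : is_derive (0 : R) 1 (G x) (f x).
  by have := Gd x 0; rewrite scale0r addr0.
exact: is_deriveB.
Qed.

End mean_along.

(** * Induction on the number of directions *)

(** Nonvanishing of the directions is a separate hypothesis because pairwise independence is vacuous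
    for a single direction. *)
Lemma ridge_smoothing (R : realType) n (a : 'I_n -> 'rV[R]_2) s f
    (a0 : forall i, a i != 0)
    (a_indep : forall i j, i != j -> free [:: a i; a j]) :
  Cs s f -> ridge_rep (fun=> True) a f -> ridge_rep (@Cs1 R s) a f.
Proof.
elim: n a a0 a_indep s f => [|n ih] a a0 a_indep s f fC [fi [_ fE]].
  by exists fi; split=> [[]|].
set b := a ord0; pose l := perp b; pose a' i := a (lift ord0 i).
have al i : dot (a' i) l != 0 by apply/free_dot_perp/a_indep; rewrite eq_sym neq_lift.
have a'_indep i j : i != j -> free [:: a' i; a' j].
  by move=> ij; apply: a_indep; rewrite (inj_eq lift_inj).
have {}ih := ih a' (fun i => a0 _) a'_indep.
pose f' i := fi (lift ord0 i).
(* The component in direction [b] cancels since [dot b l = 0]. *)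
have diffE (h : R) x : f (x + h *: l) - f x =
    \sum_(i < n) (f' i (dot (a' i) x + h * dot (a' i) l) - f' i (dot (a' i) x)).
  rewrite !fE !big_ord_recl dotD dotZ dot_perp mulr0 addr0 opprD addrACA.
  rewrite subrr add0r -sumrB; apply: eq_bigr => i _.
  by rewrite dotD dotZ.
case: s fC => [[fc _]|s fC].
  have /choice[G Gd] x : exists G : R -> R,
      forall t : R, is_derive t 1 G (f (x + t *: l)).
    apply: continuous_primitive => t.
    have : x + u *: l @[u --> t] --> x + t *: l.
      by apply: cvgD; [exact: cvg_cst|exact: scalel_continuous].
    by move=> zc; exact: cvg_comp zc (@fc _).
  pose mean x := G x 1 - G x 0.
  have meanc : continuous mean by exact: mean_continuous.
  have [L LE] := mean_functional R.
  have fmean : ridge_rep (@Cs1 R 0) a' (fun x => f x + -1 * mean x).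
    apply: ih.
      by split=> //; apply: continuous_add => //; exact: continuous_mull.
    (* [f x - mean x] is the mean over [u] of [f x - f (x + u *: l)], and for each [u] this
       difference involves only the directions [a']. *)
    rewrite (_ : (fun x => _) = fun x => L (fun u => f x - f (x + u *: l))).
      apply: (@ridge_rep_functional _ _ _ _ L
        (fun i t u => - (f' i (t + u * dot (a' i) l) - f' i t))) => x u.
      by rewrite -opprB diffE sumrN.
    apply/funext => x.
    have H (t : R) : is_derive t 1 (f x *: id - G x) (f x - f (x + t *: l)).
      have := is_deriveB (is_deriveZ (f x) (is_derive_id t (1 : R))) (Gd x t).
      by rewrite [_%:A]mulr1.
    by rewrite (LE _ _ H) !fctE /GRing.scale/= /mean; ring.
  have dmean : ridge_rep (@Cs1 R 0) a' (fun x => f (x + l) - f x).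
    apply: ih.
      by split=> // x; apply: cvgB (fc _); exact: continuous_translate.
    exists (fun i t => f' i (t + dot (a' i) l) - f' i t); split=> // x.
    by rewrite -[l]scale1r diffE; apply: eq_bigr => i _; rewrite mul1r scale1r.
  have meanC : ridge_rep (@Cs1 R 0) a mean.
    have [g [gC gE]] := dmean.
    apply: (@ridge_rep_of_derive _ _ _ _ g) => //.
    - by move=> x; rewrite -(gE x); have := is_derive_mean Gd x.
    (* The primitive is even of class [C^1]; only its continuity is kept. *)
    - by move=> i H Hd; have [] := Cs1_primitive Hd (gC i).
    - by move=> i; exact: Cs1_continuous (gC i).
  have [g [gC gE]] := fmean.
  have fC' : ridge_rep (@Cs1 R 0) a (fun x => f x + -1 * mean x).
    (* The representation over [a'] is padded with a zero component in direction [b]. *)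
    apply: (@ridge_rep_recl _ _ _ _ _ (fun=> 0) g) => //.
      exact: Cs1_cst.
    by move=> x; rewrite add0r gE.
  have := ridge_repD fC' meanC.
  by congr ridge_rep; apply/funext => x; rewrite mulN1r subrK.
(* Writing the derivative along [l] through the partial derivatives makes its class [Cs s]
   visible. *)
pose D x := \sum_(j < 2) l ord0 j * 'D_(delta_mx ord0 j) f x.
have fD x : is_derive x l f (D x).
  apply: (@is_derive_partials R 2 f (fun j => 'D_(delta_mx ord0 j) f)) => j.
    by move=> y; apply: derivableP; have [_ /(_ j)[]] := fC.
  by have [_ /(_ j)[_ /Cs_continuous]] := fC.
have DC : Cs s D.
  by apply: Cs_sum => j; apply: CsZ; have [_ /(_ j)[]] := fC.
have [L LE] := limit_functional R.
have [g [gC gE]] : ridge_rep (@Cs1 R s) a' D.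
  apply: ih => //.
  (* The value of the quotient at [u = 0] is harmless, since [L] extends the limit over a punctured
     neighbourhood. *)
  rewrite (_ : D = fun x => L (fun u => u^-1 * (f (u *: l + x) - f x))).
    apply: (@ridge_rep_functional _ _ _ _ L
      (fun i t u => u^-1 * (f' i (t + u * dot (a' i) l) - f' i t))) => x u.
    by rewrite [u *: l + x]addrC diffE mulr_sumr.
  by apply/funext => x; apply/esym/LE/is_deriveP.
apply: (@ridge_rep_of_derive _ _ _ _ g) => //.
- by move=> x; rewrite -gE.
- by move=> i G Gd; exact: Cs1_primitive Gd (gC i).
- by move=> i; exact: Cs1_continuous (gC i).
Qed.

Theorem mainTheorem3 (R : realType) (k s : nat) (a : 'I_k -> 'rV[R]_2)
    (a_indep : forall i j : 'I_k, i != j -> free [:: a i; a j])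
    (f : 'rV[R]_2 -> R) (fCs : Cs s f)
    (fi : 'I_k -> R -> R)
    (fE : forall x : 'rV[R]_2, f x = \sum_(i < k) fi i (dot (a i) x)) :
  exists g : 'I_k -> R -> R,
    (forall i : 'I_k, Cs1 s (g i)) /\
    (forall x : 'rV[R]_2, f x = \sum_(i < k) g i (dot (a i) x)).
Proof.
have [a0|/existsNP[i /negP/negPn/eqP ai0]] := pselect (forall i, a i != 0).
  by apply: ridge_smoothing => //; exists fi.
(* A zero direction is independent of no other vector, so it must be the only direction, and [f] is
   then constant. *)
have only j : j = i.
  apply/eqP/negPn/negP => /a_indep; rewrite ai0 free_cons => /andP[_].
  by rewrite seq1_free eqxx.
exists (fun j _ => fi j 0); split=> [j|x]; first exact: Cs1_cst.
rewrite fE; apply: eq_bigr => j _; rewrite (only j) ai0 /dot big1// => m _.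
by rewrite mxE mul0r.
Qed.
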